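(* Let $G$ be a commutative group, $m\colon G\to\mathbb{C}$ an exponential, and let $(a_k)_{k\ge1}$ be a sequence of additive functions $a_k\colon G\to\mathbb{C}$. For each $n\in\mathbb{N}$ and $x\in G$ define $$f_n(x)=B_n(a_1(x),\ldots,a_n(x))\,m(x),$$ where $B_n$ is the $n$-th complete (exponential) Bell polynomial (so $f_0=m$). Then $(f_n)_{n\in\mathbb{N}}$ forms a generalized moment sequence associated with the exponential $m$.
   Context: $\mathbb{N}$ is the set of nonnegative integers; groups are written additively. An exponential on $G$ is a function $m\colon G\to\mathbb{C}$, not identically zero, with $m(x+y)=m(x)m(y)$ for all $x,y\in G$. An additive function is a homomorphism $G\to(\mathbb{C},+)$. A sequence $(f_n)_{n\in\mathbb{N}}$ of functions $f_n\colon G\to\mathbb{C}$ is a generalized moment sequence if $f_0(0)=1$ and $$f_n(x+y)=\sum_{j=0}^{n}\binom{n}{j}f_j(x)f_{n-j}(y)$$ for all $n\in\mathbb{N}$ and $x,y\in G$; it is associated with the exponential $m$ if $f_0=m$. The complete (exponential) Bell polynomials are defined by $B_0=1$ and, for $n=0,1,2,\ldots$, $$B_{n+1}(t_1,\ldots,t_{n+1})=\sum_{i=0}^{n}\binom{n}{i}B_{n-i}(t_1,\ldots,t_{n-i})\,t_{i+1};$$ equivalently $\exp\left(\sum_{j=1}^\infty x_j\frac{t^j}{j!}\right)=\sum_{n=0}^\infty B_n(x_1,\ldots,x_n)\frac{t^n}{n!}$ as formal power series. *)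

(* Defs.v *)
From HB Require Import structures.
From mathcomp Require Import all_boot all_order all_algebra.
From mathcomp Require Import reals complex mpoly.

Set Implicit Arguments.
Unset Strict Implicit.
Unset Printing Implicit Defensive.

Import GRing.Theory.
Local Open Scope ring_scope.

(* [:: B_0; ...; B_n] in the arguments t 1, t 2, ... ; t 0 is never used. *)
Fixpoint bell_list (A : comNzRingType) (t : nat -> A) (n : nat) : seq A :=
  if n isn't k.+1 then [:: 1] else
  let s := bell_list t k in
  rcons s (\sum_(i < k.+1) 'C(k, i)%:R * s`_(k - i) * t i.+1).

(* The variable t_(i + 1) of the usual notation is 'X_i with i : 'I_n. *)
Definition bell_poly (A : comNzRingType) (n : nat) : {mpoly A[n]} :=
  (bell_list
     (fun k => if insub k.-1 is Some i then 'X_i else 0 : {mpoly A[n]}) n)`_n.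

Lemma size_bell_list (A : comNzRingType) (t : nat -> A) n :
  size (bell_list t n) = n.+1.
Proof. by elim: n => //= n IHn; rewrite size_rcons IHn. Qed.

Lemma nth_bell_list (A : comNzRingType) (t : nat -> A) n k :
  (k <= n)%N -> (bell_list t n)`_k = (bell_list t k)`_k.
Proof.
elim: n => [|n IHn]; first by rewrite leqn0 => /eqP ->.
rewrite leq_eqVlt => /predU1P [-> //|lt_kn].
by rewrite /= nth_rcons size_bell_list lt_kn IHn.
Qed.

Lemma bell_list_nthS (A : comNzRingType) (t : nat -> A) n :
  (bell_list t n.+1)`_n.+1 =
  \sum_(i < n.+1) 'C(n, i)%:R * (bell_list t (n - i))`_(n - i) * t i.+1.
Proof.
rewrite /= nth_rcons size_bell_list ltnn eqxx.
by apply: eq_bigr => i _; rewrite (nth_bell_list _ (leq_subr i n)).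
Qed.

Lemma bell_polyE (A : comNzRingType) (t : nat -> A) n :
  (bell_poly A n).@[fun i => t i.+1] = (bell_list t n)`_n.
Proof.
rewrite /bell_poly; set X := (X in bell_list X _).
have XE k : (k < n)%N -> (X k.+1).@[fun i : 'I_n => t i.+1] = t k.+1.
  by move=> lt_kn; rewrite /X /= insubT mevalXU.
suff main k : (k <= n)%N ->
    ((bell_list X k)`_k).@[fun i : 'I_n => t i.+1] = (bell_list t k)`_k.
  exact: main.
elim/ltn_ind: k => -[|k] IHk le_kn; first by rewrite /= meval1.
rewrite !bell_list_nthS raddf_sum; apply: eq_bigr => i _ /=.
rewrite !mevalM mevalMn meval1 IHk ?ltnS ?leq_subr //; last first.
  exact: leq_trans (leq_subr i k) (ltnW le_kn).
by rewrite XE // (leq_trans (ltn_ord i)).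
Qed.

Lemma bell_poly0 (A : comNzRingType) : bell_poly A 0 = 1.
Proof. by []. Qed.

(* The defining recursion of the complete Bell polynomials, at any values. *)
Lemma bell_polyS (A : comNzRingType) (t : nat -> A) n :
  (bell_poly A n.+1).@[fun i => t i.+1] =
  \sum_(i < n.+1)
    'C(n, i)%:R * (bell_poly A (n - i)).@[fun k => t k.+1] * t i.+1.
Proof.
rewrite bell_polyE bell_list_nthS.
by apply: eq_bigr => i _; rewrite bell_polyE.
Qed.

Definition is_exponential (R : realType) (G : zmodType) (m : G -> R[i]) : Prop :=
  (exists x, m x <> 0) /\ forall x y, m (x + y) = m x * m y.

Definition is_generalized_moment_sequence (R : realType) (G : zmodType)
    (f : nat -> G -> R[i]) : Prop :=
  f 0 0 = 1 /\
  forall n x y,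
    f n (x + y) = \sum_(j < n.+1) 'C(n, j)%:R * f j x * f (n - j)%N y.

Definition is_associated_with (R : realType) (G : zmodType)
    (f : nat -> G -> R[i]) (m : G -> R[i]) : Prop :=
  forall x, f 0 x = m x.

(* Only a 1, a 2, ... occur: the family (a_k) starts at k = 1. *)
Definition bell_moment (R : realType) (G : zmodType) (m : G -> R[i])
    (a : nat -> {additive G -> R[i]}) (n : nat) (x : G) : R[i] :=
  (bell_poly R[i] n).@[fun i : 'I_n => a i.+1 x] * m x.

(* Main.v *)
(* The binomial convolution of two sequences is the product of their exponential
   generating functions, and the shift is the derivative.  The sequence B_n(t)
   is the solution B of B' = t' B with B(0) = 1; by the Leibniz rule the product
   of the solutions for s and t solves the equation for s + t, so the Bell
   polynomials are of binomial type. *)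

Require Import Defs.
From HB Require Import structures.
From mathcomp Require Import all_boot all_order all_algebra.
From mathcomp Require Import reals complex mpoly.

Set Implicit Arguments.
Unset Strict Implicit.
Unset Printing Implicit Defensive.

Import GRing.Theory.
Local Open Scope ring_scope.

Definition binconv (A : comNzRingType) (f g : nat -> A) (n : nat) : A :=
  \sum_(j < n.+1) 'C(n, j)%:R * f j * g (n - j)%N.

Section BinomialConvolution.
Variable A : comNzRingType.
Implicit Types f g h s t : nat -> A.

Local Notation shift f := (fun k => f k.+1).

(** Agreement is asked only up to [n], so that a strong induction hypothesis can be rewritten inside
    a convolution. *)
Lemma eq_binconv f f' g g' n :
  (forall k, (k <= n)%N -> f k = f' k) -> (forall k, (k <= n)%N -> g k = g' k) ->
  binconv f g n = binconv f' g' n.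
Proof.
move=> eq_f eq_g; apply: eq_bigr => i _.
by rewrite eq_f ?eq_g ?leq_subr // -ltnS.
Qed.

Lemma binconv0 f g : binconv f g 0 = f 0%N * g 0%N.
Proof. by rewrite /binconv big_ord1 mul1r. Qed.

Lemma binconvS f g n :
  binconv f g n.+1 = binconv (shift f) g n + binconv f (shift g) n.
Proof.
(* The extra top term vanishes since $\binom{n}{n+1}=0$. With equal ranges, Pascal's rule matches
   the terms with $j\ge1$, and those with $j=0$ agree. *)
have -> : binconv f (shift g) n =
    \sum_(j < n.+2) 'C(n, j)%:R * f j * g (n.+1 - j)%N.
  rewrite big_ord_recr /= bin_small // !mul0r addr0.
  by apply: eq_bigr => i _; rewrite subSn // -ltnS.
rewrite /binconv big_ord_recl [X in _ = _ + X]big_ord_recl /= !bin0 addrCA.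
congr (_ + _); rewrite -big_split; apply: eq_bigr => i _ /=.
by rewrite /bump /= add1n subSS binS natrD !mulrDl addrC.
Qed.

Lemma binconvDl f g h n :
  binconv (fun k => f k + g k) h n = binconv f h n + binconv g h n.
Proof. by rewrite -big_split; apply: eq_bigr => i _; rewrite mulrDr mulrDl. Qed.

Lemma binconvDr f g h n :
  binconv f (fun k => g k + h k) n = binconv f g n + binconv f h n.
Proof. by rewrite -big_split; apply: eq_bigr => i _; rewrite mulrDr. Qed.

Lemma binconvC f g n : binconv f g n = binconv g f n.
Proof.
elim: n f g => [|n IHn] f g; first by rewrite !binconv0 mulrC.
by rewrite !binconvS addrC [binconv f _ n]IHn [binconv _ g n]IHn.
Qed.

(** By the Leibniz rule both sides have the same three-term derivative, so induction on [n] replaces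
    any reindexing of double sums. *)
Lemma binconvA f g h n :
  binconv f (binconv g h) n = binconv (binconv f g) h n.
Proof.
elim: n f g h => [|n IHn] f g h; first by rewrite !binconv0 mulrA.
rewrite !binconvS.
rewrite (@eq_binconv f f (shift (binconv g h))
  (fun k => binconv (shift g) h k + binconv g (shift h) k)) //; last first.
  by move=> k _; exact: binconvS.
rewrite (@eq_binconv (shift (binconv f g))
  (fun k => binconv (shift f) g k + binconv f (shift g) k) h h) //; last first.
  by move=> k _; exact: binconvS.
by rewrite binconvDl binconvDr !IHn addrA.
Qed.

(** The differential equation $B'=t'B$, read off coefficientwise. *)
Lemma bell_list_nthS_binconv t n :
  (bell_list t n.+1)`_n.+1 =
  binconv (shift t) (fun k => (bell_list t k)`_k) n.
Proof.
by rewrite bell_list_nthS; apply: eq_bigr => i _; rewrite mulrAC.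
Qed.

Lemma bell_list_nthD s t n :
  (bell_list (fun k => s k + t k) n)`_n =
  binconv (fun k => (bell_list s k)`_k) (fun k => (bell_list t k)`_k) n.
Proof.
pose b u k : A := (bell_list u k)`_k.
have bS u k : b u k.+1 = binconv (shift u) (b u) k.
  exact: bell_list_nthS_binconv.
rewrite -/(b _ n) -/(b s) -/(b t).
elim/ltn_ind: n => -[|n] IHn; first by rewrite binconv0 /b /= mulr1.
(* The induction hypothesis replaces all earlier values for $s+t$ by the product; there remains
   $(s'+t')(B_sB_t)=(B_sB_t)'$. *)
rewrite bS (@eq_binconv _ (shift (fun k => s k + t k)) _ (binconv (b s) (b t))) //.
rewrite binconvDl binconvS; congr (_ + _).
  by rewrite binconvA; apply: eq_binconv => k _ //; rewrite bS.
(* Swapping the factors puts $t'$ next to $B_t$, where $t'B_t=B_t'$ applies. *)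
rewrite (@eq_binconv _ (shift t) _ (binconv (b t) (b s))) //; last first.
  by move=> k _; exact: binconvC.
by rewrite binconvA binconvC; apply: eq_binconv => k _ //; rewrite bS.
Qed.

Lemma eq_bell_list s t n : s =1 t -> bell_list s n = bell_list t n.
Proof.
move=> eq_st; elim: n => //= n ->; congr rcons.
by apply: eq_bigr => i _; rewrite eq_st.
Qed.

End BinomialConvolution.

Lemma exponential0 (R : realType) (G : zmodType) (m : G -> R[i]) :
  is_exponential m -> m 0 = 1.
Proof.
move=> [[x /eqP mx_neq0] mD]; apply: (mulfI mx_neq0).
by rewrite -mD addr0 mulr1.
Qed.

Theorem corollary1 (R : realType) (G : zmodType) (m : G -> R[i])
    (hm : is_exponential m) (a : nat -> {additive G -> R[i]}) :
  is_generalized_moment_sequence (bell_moment m a) /\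
  is_associated_with (bell_moment m a) m.
Proof.
have bmE n x : bell_moment m a n x = (bell_list (fun k => a k x) n)`_n * m x.
  by rewrite /bell_moment -bell_polyE.
have bm0 x : bell_moment m a 0 x = m x by rewrite bmE mul1r.
split=> //; split=> [|n x y]; first by rewrite bm0 exponential0.
(* Additivity turns the arguments at $x+y$ into a sum of two sequences, where binomial type
   applies. *)
rewrite bmE (@eq_bell_list _ _ (fun k => a k x + a k y)); last first.
  by move=> k; rewrite raddfD.
have [_ mD] := hm.
rewrite bell_list_nthD mD mulr_suml; apply: eq_bigr => j _.
by rewrite !bmE !mulrA; congr (_ * _); rewrite mulrAC.
Qed.
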